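(* Let $\mathbf K$ be $\mathbf H$ or $\mathbf O$ and let $U$ be an open domain in $\mathbf K$. If $f:U\to\mathbf K$ is a pseudoconformal function on $U$ and $E$ is the set of zeros of $f$ in $U$, then each zero of $f$ is an isolated point of $E$.
   Context: $\mathbf K$ is the quaternion skew field $\mathbf H$ ($r=2$) or the octonion algebra $\mathbf O$ ($r=3$); $\tilde z=z^*$ is the conjugate, $|z|^2=z\tilde z$, $\mathrm{Re}(z)=(z+\tilde z)/2$. Functions of $z$ are represented by phrases (finite or convergent infinite sums of bracketed words in $z$, $\tilde z$ and constants of $\mathbf K$); $\partial f/\partial z$ and $\partial f/\partial\tilde z$ are the partial (super)derivatives, $\mathbf R$-linear operators $h\mapsto(\partial f/\partial z).h$, $h\mapsto(\partial f/\partial\tilde z).h$ whose sum is the Fréchet derivative. A differentiable $f:U\to\mathbf K$ is pseudoconformal at $\xi\in U$ if (1) $\partial f(z)/\partial\tilde z=0$ at $z=\xi$; (2) writing $f'(\xi)=(\partial f/\partial z)|_{z=\xi}$, $\mathrm{Re}\{[f'(\xi).h_1][f'(\xi).h_2]^*\}|h_1||h_2|=|f'(\xi).h_1||f'(\xi).h_2|\,\mathrm{Re}(h_1\tilde h_2)$ for all $h_1,h_2\in\mathbf K$; (3) $f'(\xi)\neq0$; where nonproper rotations of the underlying space $\mathbf R^{2^r}$ associated with $f'$ are excluded. $f$ is pseudoconformal on $U$ if it is so at each point of $U$. *)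

(* Defs.v *)
From HB Require Import structures.
From mathcomp Require Import all_boot all_order all_algebra.
From mathcomp Require Import all_classical all_reals all_analysis.

Set Implicit Arguments.
Unset Strict Implicit.
Unset Printing Implicit Defensive.

Import Order.TTheory GRing.Theory Num.Theory.
Import numFieldNormedType.Exports.

Local Open Scope classical_set_scope.
Local Open Scope ring_scope.

(* [cddim r] is [2 ^ r], computed so that [cddim r.+1] is convertible to
   [cddim r + cddim r]; this is what makes the block operations
   [row_mx], [lsubmx], [rsubmx] directly applicable below. *)
Fixpoint cddim (r : nat) : nat :=
  if r is r'.+1 then (cddim r' + cddim r')%N else 1%N.

(* The Cayley-Dickson algebra of real dimension [2 ^ r]: the quaternions for
   [r = 2] and the octonions for [r = 3]. As a normed space it carries the sup
   norm of the coordinates, written [`|z|]; it is equivalent to the modulus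
   [cdnorm] below, so the topology and Frechet derivatives are the usual ones,
   but only [cdnorm] is the modulus of the algebra. *)
Notation CD R r := 'rV[R]_(cddim r).

Section CayleyDickson.
Variable R : realType.

Fixpoint cdconj (r : nat) : CD R r -> CD R r :=
  match r return CD R r -> CD R r with
  | 0 => fun x => x
  | r'.+1 => fun x : 'rV[R]_(cddim r' + cddim r') =>
      row_mx (cdconj (lsubmx x)) (- rsubmx x)
  end.

(* (a + b l)(c + d l) = (a c - d~ b) + (d a + b c~) l *)
Fixpoint cdmul (r : nat) : CD R r -> CD R r -> CD R r :=
  match r return CD R r -> CD R r -> CD R r with
  | 0 => fun x y => x *m y
  | r'.+1 => fun x y : 'rV[R]_(cddim r' + cddim r') =>
      let a := lsubmx x in let b := rsubmx x in
      let c := lsubmx y in let d := rsubmx y in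
      row_mx (cdmul a c - cdmul (cdconj d) b) (cdmul d a + cdmul b (cdconj c))
  end.

Fixpoint cdone (r : nat) : CD R r :=
  match r return CD R r with
  | 0 => 1%:M
  | r'.+1 => row_mx (cdone r') 0
  end.

(* Re z as a real number; [cdreE] relates it to [(z + z~) / 2]. *)
Fixpoint cdre (r : nat) : CD R r -> R :=
  match r return CD R r -> R with
  | 0 => fun x => x 0 0
  | r'.+1 => fun x : 'rV[R]_(cddim r' + cddim r') => cdre (lsubmx x)
  end.

(* The modulus; [cdnormE] proves [|z|^2 = z z~]. *)
Definition cdnorm (r : nat) (z : CD R r) : R :=
  Num.sqrt (cdre (cdmul z (cdconj z))).

Lemma cdreE r (z : CD R r) :
  cdre z *: cdone r = 2^-1 *: (z + cdconj z).
Proof.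
elim: r z => [|r IH] z /=.
  rewrite -mulr2n -[z *+ 2]scaler_nat scalerA mulVf ?pnatr_eq0// scale1r.
  by apply/rowP => i; rewrite !mxE !ord1 eqxx mulr1.
rewrite scale_row_mx IH scaler0 -[X in X + row_mx _ _]hsubmxK add_row_mx subrr.
by rewrite scale_row_mx scaler0.
Qed.

Lemma cdconjN r (z : CD R r) : cdconj (- z) = - cdconj z.
Proof.
elim: r z => [//|r IH] z /=.
by rewrite opp_row_mx !linearN /= IH.
Qed.

Lemma cdconjK r (z : CD R r) : cdconj (cdconj z) = z.
Proof.
elim: r z => [//|r IH] z /=.
by rewrite row_mxKl row_mxKr IH opprK hsubmxK.
Qed.

Lemma cdmulN r (x y : CD R r) :
  cdmul (- x) y = - cdmul x y /\ cdmul x (- y) = - cdmul x y.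
Proof.
elim: r x y => [|r IH] x y /=; first by rewrite mulNmx mulmxN.
rewrite opp_row_mx !linearN /= !cdconjN; split; congr row_mx.
- by rewrite (IH _ _).1 (IH _ _).2 opprB opprK addrC.
- by rewrite (IH _ _).1 (IH _ _).2 opprD.
- by rewrite (IH _ _).1 (IH _ _).2 opprB opprK addrC.
- by rewrite (IH _ _).1 (IH _ _).2 opprD.
Qed.

Lemma cdre_one r (a : R) : cdre (a *: cdone r) = a.
Proof.
elim: r => [|r IH] /=; first by rewrite !mxE eqxx mulr1.
by rewrite scale_row_mx row_mxKl IH.
Qed.

Lemma cdmul_conj r (z : CD R r) :
  let q := \sum_i z 0 i ^+ 2 in
  cdmul z (cdconj z) = q *: cdone r /\ cdmul (cdconj z) z = q *: cdone r.
Proof.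
elim: r z => [|r IH] z /=.
  by split; apply/rowP => i; rewrite !mxE !ord1 !big_ord1 eqxx mulr1.
have -> : \sum_i z 0 i ^+ 2 = \sum_i (lsubmx z) 0 i ^+ 2
    + \sum_i (rsubmx z) 0 i ^+ 2 :> R.
  by rewrite big_split_ord /=; congr (_ + _); apply: eq_bigr => i _; rewrite mxE.
rewrite !row_mxKl !row_mxKr !cdconjK !cdconjN.
rewrite !(cdmulN _ _).1 !(cdmulN _ _).2 !opprK.
rewrite (IH (lsubmx z)).1 (IH (lsubmx z)).2 (IH (rsubmx z)).2.
by rewrite -scalerDl !scale_row_mx scaler0 addNr subrr.
Qed.

Lemma cdnormE r (z : CD R r) :
  cdnorm z = Num.sqrt (\sum_i z 0 i ^+ 2) /\
  cdmul z (cdconj z) = cdnorm z ^+ 2 *: cdone r.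
Proof.
rewrite /cdnorm (cdmul_conj z).1 cdre_one sqr_sqrtr//.
by apply: sumr_ge0 => i _; exact: sqr_ge0.
Qed.

End CayleyDickson.

(* Bracketed words in z, z~ and constants. *)
Inductive word (R : realType) (r : nat) : Type :=
| WVar
| WConj
| WCst of CD R r
| WMul of word R r & word R r.

Arguments WVar {R r}.
Arguments WConj {R r}.

Section Phrases.
Variables (R : realType) (r : nat).
Local Notation K := (CD R r).

Fixpoint weval (w : word R r) (z : K) : K :=
  match w with
  | WVar => z
  | WConj => cdconj z
  | WCst a => a
  | WMul u v => cdmul (weval u z) (weval v z)
  end.

(* Partial derivatives of a word at z in the direction h, with z and z~ treated
   as independent variables. In the z~-derivative an occurrence of z~ is
   replaced by h~ (not by h), so that the two partial derivatives add up to the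
   Frechet derivative at z applied to h. *)
Fixpoint wdz (w : word R r) (z h : K) : K :=
  match w with
  | WVar => h
  | WConj => 0
  | WCst _ => 0
  | WMul u v => cdmul (wdz u z h) (weval v z) + cdmul (weval u z) (wdz v z h)
  end.

Fixpoint wdzb (w : word R r) (z h : K) : K :=
  match w with
  | WVar => 0
  | WConj => cdconj h
  | WCst _ => 0
  | WMul u v => cdmul (wdzb u z h) (weval v z) + cdmul (weval u z) (wdzb v z h)
  end.

(* An infinite sum of words; finite sums are padded with [WCst 0]. *)
Definition phrase : Type := nat -> word R r.

(* [f] is differentiable on [U], with partial derivatives [dz] (in z) and
   [dzb] (in z~). The partial derivatives belong to the phrase and not to the
   mere map [f]: over the quaternions and the octonions z~ is itself the value
   of a phrase in z alone. Phrases are only required locally, as for power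
   series with varying centres; a phrase valid on all of [U] is a special case. *)
Definition superdifferentiable_on (U : set K) (f : K -> K)
    (dz dzb : K -> {linear K -> K}) : Prop :=
  (forall a, U a -> exists p : phrase, \forall z \near a,
     series (fun n => weval (p n) z) @ \oo --> f z /\
     forall h : K,
       series (fun n => wdz (p n) z h) @ \oo --> dz z h /\
       series (fun n => wdzb (p n) z h) @ \oo --> dzb z h) /\
  (forall z, U z -> differentiable f z /\
     forall h : K, 'd f z h = dz z h + dzb z h).

(* An element of O(n) \ SO(n). *)
Definition nonproper_rotation (n : nat) (Q : 'M[R]_n) : Prop :=
  Q *m Q^T = 1%:M /\ \det Q = -1.

(* [dz xi] plays the role of f'(xi). The last clause excludes that f'(xi) be
   a positive multiple of a nonproper rotation of R^(2^r). *)
Definition pseudoconformal_at (dz dzb : K -> {linear K -> K}) (xi : K) : Prop :=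
  [/\ forall h : K, dzb xi h = 0,
      forall h1 h2 : K,
        cdre (cdmul (dz xi h1) (cdconj (dz xi h2))) * cdnorm h1 * cdnorm h2 =
        cdnorm (dz xi h1) * cdnorm (dz xi h2) * cdre (cdmul h1 (cdconj h2)),
      exists h : K, dz xi h <> 0 &
      forall (c : R) (Q : 'M[R]_(cddim r)),
        0 < c -> nonproper_rotation Q -> lin1_mx (dz xi) <> c *: Q].

Definition pseudoconformal_on (U : set K) (f : K -> K) : Prop :=
  exists dz dzb : K -> {linear K -> K},
    superdifferentiable_on U f dz dzb /\
    forall xi, U xi -> pseudoconformal_at dz dzb xi.

End Phrases.

(* Main.v *)
Require Import Defs.
From mathcomp Require Import all_boot all_order all_algebra.
From mathcomp Require Import all_classical all_reals all_analysis.
From mathcomp Require Import ring lra.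
Import Order.TTheory GRing.Theory Num.Theory.
Import numFieldNormedType.Exports.
Local Open Scope classical_set_scope.
Local Open Scope ring_scope.

(** At a zero [z] of [f] the Frechet derivative of [f] is [f'(z)], because the
    derivative in [z~] vanishes there. The conformality identity says that
    [f'(z)] preserves angles, and a nonzero linear map with this property is
    injective ([conformal_injective]): if it killed a direction [h] but not
    [h0], then [h0] and [h0 + h] would have the same image, so the angle between
    them would be zero, [h] would be parallel to [h0], and [h0] would be killed
    as well. In finite dimension an injective derivative is bounded below, so
    near [z] it dominates the remainder of the first-order expansion and [f]
    does not take the value [f z] a second time
    ([injective_diff_locally_injective_at]). *)

Definition dot {R : realType} {n : nat} (x y : 'rV[R]_n) : R :=
  \sum_i x 0 i * y 0 i.

Lemma dotC {R : realType} {n : nat} (x y : 'rV[R]_n) : dot x y = dot y x.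
Proof. by apply: eq_bigr => i _; rewrite mulrC. Qed.

Lemma dotDl {R : realType} {n : nat} (x1 x2 y : 'rV[R]_n) :
  dot (x1 + x2) y = dot x1 y + dot x2 y.
Proof. by rewrite -big_split; apply: eq_bigr => i _; rewrite mxE mulrDl. Qed.

Lemma dotDr {R : realType} {n : nat} (x y1 y2 : 'rV[R]_n) :
  dot x (y1 + y2) = dot x y1 + dot x y2.
Proof. by rewrite dotC dotDl !(dotC _ x). Qed.

Lemma dotZl {R : realType} {n : nat} a (x y : 'rV[R]_n) :
  dot (a *: x) y = a * dot x y.
Proof. by rewrite mulr_sumr; apply: eq_bigr => i _; rewrite mxE mulrA. Qed.

Lemma dotZr {R : realType} {n : nat} a (x y : 'rV[R]_n) :
  dot x (a *: y) = a * dot x y.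
Proof. by rewrite dotC dotZl dotC. Qed.

Lemma dot_ge0 {R : realType} {n : nat} (x : 'rV[R]_n) : 0 <= dot x x.
Proof. by apply: sumr_ge0 => i _; rewrite -expr2 sqr_ge0. Qed.

Lemma dot_eq0 {R : realType} {n : nat} (x : 'rV[R]_n) :
  (dot x x == 0) = (x == 0).
Proof.
rewrite psumr_eq0 => [|i _]; last by rewrite -expr2 sqr_ge0.
apply/allP/eqP => [x0|-> i _]; last by rewrite mxE mulr0 eqxx.
apply/rowP => i; apply/eqP.
by have := x0 i (mem_index_enum i); rewrite -expr2 sqrf_eq0 mxE.
Qed.

(** The equality case of the Cauchy-Schwarz inequality: the difference of
    the two sides of the conclusion has squared length [dot y y] times the defect
    of the inequality. *)
Lemma dot_sqr_eq_parallel {R : realType} {n : nat} (x y : 'rV[R]_n) :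
  dot x y ^+ 2 = dot x x * dot y y -> dot y y *: x = dot x y *: y.
Proof.
move=> eq_xy; apply/eqP; rewrite -subr_eq0 -dot_eq0; apply/eqP.
rewrite -scaleNr; set a := dot y y; set b := dot x y.
have -> : dot (a *: x + - b *: y) (a *: x + - b *: y) =
    a * (dot x x * a - b ^+ 2).
  rewrite !dotDl !dotDr !dotZl !dotZr (dotC y x) -/a -/b.
  by ring.
by rewrite -eq_xy subrr mulr0.
Qed.

(** Both products are needed at once: the left block of a Cayley-Dickson product
    contains one term with the conjugate on the left and one with it on the
    right. *)
Lemma cdre_mul_conj {R : realType} {r : nat} (x y : CD R r) :
  cdre (cdmul x (cdconj y)) = dot x y /\ cdre (cdmul (cdconj x) y) = dot x y.
Proof.
have cdreD k (u v : CD R k) : cdre (u + v) = cdre u + cdre v.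
  by elim: k u v => [|k IH] u v /=; [rewrite mxE | rewrite linearD IH].
elim: r x y => [|r IH] x y /=.
  by rewrite /dot /= !big_ord1 !mxE !big_ord1 ?mxE.
have -> : dot x y = dot (lsubmx x) (lsubmx y) + dot (rsubmx x) (rsubmx y).
  rewrite /dot big_split_ord /=.
  by congr (_ + _); apply: eq_bigr => i _; rewrite !mxE.
rewrite !row_mxKl !row_mxKr !cdconjN !(cdmulN _ _).1 !(cdmulN _ _).2 !opprK.
by rewrite !cdreD !(IH _ _).1 !(IH _ _).2 (dotC (rsubmx y)).
Qed.

Lemma cdnorm_dot {R : realType} {r : nat} (x : CD R r) : cdnorm x = Num.sqrt (dot x x).
Proof. by rewrite /cdnorm (cdre_mul_conj x x).1. Qed.

(** Only the case of two directions with the same image is used: there the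
    left-hand angle is zero, so the Cauchy-Schwarz inequality for the directions
    themselves is an equality. *)
Lemma conformal_injective {R : realType} {r : nat} (L : {linear CD R r -> CD R r}) :
  (forall h1 h2 : CD R r,
      cdre (cdmul (L h1) (cdconj (L h2))) * cdnorm h1 * cdnorm h2 =
      cdnorm (L h1) * cdnorm (L h2) * cdre (cdmul h1 (cdconj h2))) ->
  (exists h, L h <> 0) -> injective L.
Proof.
move=> Lconf [h0 Lh0]; apply: raddf_inj => h Lh.
have L0_neq0 : dot (L h0) (L h0) != 0 by rewrite dot_eq0; apply/eqP.
have h0_neq0 : h0 != 0 by apply/eqP => h00; apply: Lh0; rewrite h00 raddf0.
have sqr_dot := sqr_sqrtr (dot_ge0 _).
(* [h0 + h] and [h0] have the same image, hence they make a zero angle. *)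
have angle0 : cdnorm (h0 + h) * cdnorm h0 = dot (h0 + h) h0.
  have := Lconf (h0 + h) h0; rewrite linearD Lh addr0 !(cdre_mul_conj _ _).1.
  rewrite !(cdnorm_dot (L _)) -expr2 sqr_dot -mulrA.
  exact: mulfI L0_neq0 _ _.
have cs_eq : dot h h0 ^+ 2 = dot h h * dot h0 h0.
  have := congr1 (fun a => a ^+ 2) angle0; rewrite exprMn !cdnorm_dot !sqr_dot.
  rewrite !dotDl !dotDr (dotC h0 h) => sq.
  lra.
have /dot_sqr_eq_parallel par := cs_eq.
have /eqP : dot h h0 *: L h0 = 0 by rewrite -linearZZ -par linearZZ /= Lh scaler0.
rewrite scaler_eq0 -[L h0 == 0]dot_eq0 (negPf L0_neq0) orbF => /eqP hh0.
move: par; rewrite hh0 scale0r => /eqP.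
by rewrite scaler_eq0 dot_eq0 (negPf h0_neq0) => /eqP.
Qed.

Lemma linear_rV_bounded {R : realType} {n : nat} {V : normedModType R}
    (L : {linear 'rV[R]_n -> V}) :
  exists2 k : R, 0 < k & forall h, `|L h| <= k * `|h|.
Proof.
exists (1 + \sum_i `|L (delta_mx 0 i)|).
  by rewrite ltr_wpDr// sumr_ge0.
move=> h; rewrite {1}(row_sum_delta h) linear_sum.
apply: le_trans (ler_norm_sum _ _ _) _; rewrite mulrDl mul1r.
apply: ler_wpDl => //; rewrite mulr_suml; apply: ler_sum => i _.
rewrite linearZ normrZ mulrC ler_wpM2l//.
by rewrite [leRHS]/Num.Def.normr /= mx_normrE; apply/bigmax_geP; right => /=; exists (0, i).
Qed.

(** A left inverse of [L] is given by a matrix, hence is bounded, and [k] is a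
    bound for it. *)
Lemma injective_linear_bounded_below {R : realType} {m n : nat}
    (L : {linear 'rV[R]_m -> 'rV[R]_n}) :
  injective L -> exists2 k : R, 0 < k & forall h, `|h| <= k * `|L h|.
Proof.
move=> Linj; have Lfree : row_free (lin1_mx L).
  apply: inj_row_free => v; rewrite mul_rV_lin1 => Lv.
  by apply: Linj; rewrite Lv raddf0.
have [k k0 Hk] := linear_rV_bounded (mulmxr (pinvmx (lin1_mx L))).
exists k => // h; have := Hk (L h).
by rewrite /= -(mul_rV_lin1 L h) mulmxKp.
Qed.

Lemma injective_diff_locally_injective_at {R : realType} {m n : nat}
    (f : 'rV[R]_m -> 'rV[R]_n) z :
  differentiable f z -> injective ('d f z) ->
  \forall y \near z, f y = f z -> y = z.
Proof.
move=> df /injective_linear_bounded_below[k k0 Hk].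
(* The remainder is at most half of the lower bound [k^-1 * `|h|] of the linear
   part. *)
have /eqaddoP/(_ (2 * k)^-1) := diff_locally df.
rewrite invr_gt0 mulr_gt0// => /(_ isT) small.
rewrite (near_shift 0) subr0; near=> h => /= fh.
have : `|(f \o shift z - (cst (f z) + 'd f z)) h| <= (2 * k)^-1 * `|h|.
  by near: h.
rewrite !fctE /= fh opprD addNKr normrN => Lh.
have h_half : `|h| <= 2^-1 * `|h|.
  apply: le_trans (Hk h) _; rewrite -ler_pdivlMl//.
  by rewrite mulrA -invfM [k * 2]mulrC.
have /eqP-> : h == 0 by rewrite -normr_le0; lra.
by rewrite add0r.
Unshelve. all: by end_near. Qed.

Theorem theorem21 (R : realType) (r : nat) (hr : r = 2%N \/ r = 3%N)
  (U : set (CD R r)) (Uopen : open U) (f : CD R r -> CD R r)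
  (hf : pseudoconformal_on U f) :
  let E := [set z | U z /\ f z = 0] in
  forall z, E z -> isolated E z.
Proof.
move=> E z Ez; have [Uz fz0] := Ez.
case: hf => dz [dzb [[_ fdiff] conf]].
have [dzb0 angle nz _] := conf z Uz; have [df dfE] := fdiff z Uz.
have inj : injective ('d f z).
  have e : 'd f z =1 dz z by move=> h; rewrite dfE dzb0 addr0.
  by move=> x y; rewrite !e; exact: conformal_injective angle nz x y.
split; first exact: mem_set.
exists [set y | f y = f z -> y = z].
  exact: injective_diff_locally_injective_at df inj.
apply/seteqP; split=> [y [yz [_ fy0]]|_ ->] //=.
by apply: yz; rewrite fy0 fz0.
Qed.
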